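(* Let $P\in\mathbb R^{n\times n}$ be a row-stochastic matrix that is not regular, and let $\bar J=(\bar J_{ij})_{n\times n}=(I-P)^\vdash$ be the eigenprojection of $I-P$. Let $\boldsymbol v=(v_1,\ldots,v_n)^{\mathrm T}$ satisfy $v_i\ge0$ for all $i$ and $\sum_{i=1}^n v_i=1$, and let $V=\mathbf 1\boldsymbol v^{\mathrm T}$. For $\delta\in(0,1]$ let the sequence $\{\boldsymbol x^k\}$ satisfy $$\boldsymbol x^{k+1}=\big((1-\delta)P+\delta V\big)\boldsymbol x^k,\quad k=0,1,\ldots,$$ with initial vector $\boldsymbol x^0\in\mathbb R^n$ (fixed independently of $\delta$). Then: 1. $\displaystyle\lim_{k\to\infty}\boldsymbol x^k=\mathbf 1\boldsymbol v^{\mathrm T}\big(I+\gamma(I-P)\big)^{-1}\boldsymbol x^0$, where $\gamma=\delta^{-1}-1$; 2. $\displaystyle\lim_{\delta\to+0}\lim_{k\to\infty}\boldsymbol x^k=\mathbf 1\boldsymbol v^{\mathrm T}\bar J\,\boldsymbol x^0$; 3. if $\boldsymbol v=\tfrac1n\mathbf 1$, then $\displaystyle\lim_{\delta\to+0}\lim_{k\to\infty}\boldsymbol x^k=E\bar J\,\boldsymbol x^0=\mathbf 1\,\frac1n\sum_{j=1}^n\bar J_{\cdot j}\,\boldsymbol x^0_j$, where $E=\tfrac1n\mathbf 1\mathbf 1^{\mathrm T}$, $\bar J_{\cdot j}=\sum_{i=1}^n\bar J_{ij}$, and $\boldsymbol x^0_j$ is the $j$th component of $\boldsymbol x^0$.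
   Context: For a square matrix $A$ let $\nu$ be its index, i.e. the smallest $k\in\{0,1,\ldots\}$ with $\operatorname{rank}A^{k+1}=\operatorname{rank}A^k$ (where $A^0=I$); the eigenprojection $A^\vdash$ of $A$ (corresponding to the eigenvalue $0$) is the unique idempotent matrix with range $\mathcal R(A^\vdash)=\mathcal N(A^\nu)$ and null space $\mathcal N(A^\vdash)=\mathcal R(A^\nu)$. A row-stochastic matrix is called regular if it is SIA (stochastic, indecomposable, aperiodic); it is not regular when it has at least two eigenvalues (counted with multiplicity) of modulus $1$. $\mathbf 1$ is the all-ones column vector of length $n$ and $I$ is the identity matrix of order $n$. *)

(* Defs.v *)
(* World: MathComp with MathComp-Analysis. *)
From HB Require Import structures.
From mathcomp Require Import all_boot all_order all_algebra.
From mathcomp Require Import all_classical all_reals all_analysis.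

Set Implicit Arguments.
Unset Strict Implicit.
Unset Printing Implicit Defensive.

Import Order.TTheory GRing.Theory Num.Theory.
Import numFieldNormedType.Exports.

Local Open Scope classical_set_scope.
Local Open Scope ring_scope.

Definition row_stochastic (R : numDomainType) (n : nat) (P : 'M[R]_n) : Prop :=
  (forall i j, 0 <= P i j) /\ (forall i, \sum_j P i j = 1).

Definition accessible (R : numDomainType) (n : nat) (P : 'M[R]_n) (i j : 'I_n) :
    Prop :=
  exists k, 0 < (P ^+ k) i j.

(* States lying in some ergodic class. *)
Definition essential (R : numDomainType) (n : nat) (P : 'M[R]_n) (i : 'I_n) :
    Prop :=
  forall j, accessible P i j -> accessible P j i.

(* For a stochastic matrix with n > 0 there is at least one ergodic class;
   indecomposability says that there is no second one. *)
Definition indecomposable (R : numDomainType) (n : nat) (P : 'M[R]_n) : Prop :=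
  forall i j, essential P i -> essential P j -> accessible P i j.

(* Every ergodic class has period 1: the gcd of the return times of each of its
   states is 1. The periods of inessential states are not constrained. *)
Definition aperiodic (R : numDomainType) (n : nat) (P : 'M[R]_n) : Prop :=
  forall i, essential P i ->
  forall d : nat,
    (forall k : nat, (0 < k)%N -> 0 < (P ^+ k) i i -> (d %| k)%N) -> d = 1%N.

Definition SIA (R : numDomainType) (n : nat) (P : 'M[R]_n) : Prop :=
  [/\ row_stochastic P, indecomposable P & aperiodic P].

Definition regular (R : numDomainType) (n : nat) (P : 'M[R]_n) : Prop := SIA P.

Lemma mxindex_subproof (F : fieldType) (n : nat) (A : 'M[F]_n) :
  exists k, \rank (A ^+ k.+1) == \rank (A ^+ k).
Proof.
have rankS k : (\rank (A ^+ k.+1) <= \rank (A ^+ k))%N.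
  by rewrite exprS; apply: mxrankM_maxr.
apply: contrapT => nex.
suff /(_ n.+1) : forall k, (\rank (A ^+ k) + k <= n)%N.
  by rewrite addnS ltnNge leq_addl.
elim=> [|k IHk]; first by rewrite addn0 rank_leq_row.
apply: leq_trans IHk; rewrite addnS ltn_add2r ltn_neqAle rankS andbT.
by apply/negP => rkE; apply: nex; exists k.
Qed.

Definition mxindex (F : fieldType) (n : nat) (A : 'M[F]_n) : nat :=
  ex_minn (mxindex_subproof A).

(* Matrices act on column vectors here, whereas the row-space operations of
   mxalgebra refer to the action on row vectors. *)
Definition mxrange (F : fieldType) (n : nat) (A : 'M[F]_n) : set 'cV[F]_n :=
  range (mulmx A).

Definition mxnull (F : fieldType) (n : nat) (A : 'M[F]_n) : set 'cV[F]_n :=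
  [set x | A *m x = 0].

Definition is_eigenprojection (F : fieldType) (n : nat) (A Z : 'M[F]_n) : Prop :=
  [/\ Z *m Z = Z,
      mxrange Z = mxnull (A ^+ mxindex A)
    & mxnull Z = mxrange (A ^+ mxindex A)].

Lemma mxrank_mxindex (F : fieldType) (n : nat) (A : 'M[F]_n) :
  \rank (A ^+ mxindex A *m A ^+ mxindex A) = \rank (A ^+ mxindex A).
Proof.
rewrite /mxindex; case: ex_minnP => k /eqP rkE _.
have sub1 : (A ^+ k <= A ^+ k.+1)%MS.
  have sub : (A ^+ k.+1 <= A ^+ k)%MS by rewrite exprS submxMl.
  by have [_ <-] := mxrank_leqif_sup sub; rewrite rkE.
have subm m : (A ^+ k <= A ^+ (k + m))%MS.
  elim: m => [|m IHm]; first by rewrite addn0.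
  apply: submx_trans sub1 _; rewrite addnS !exprSr.
  exact: submxMr.
apply/eqP; rewrite eqn_leq mxrankM_maxl /=.
have -> : A ^+ k *m A ^+ k = A ^+ (k + k) by rewrite exprD.
exact: mxrankS.
Qed.

Lemma eigenprojection_exists (F : fieldType) (n : nat) (A : 'M[F]_n) :
  exists Z, is_eigenprojection A Z.
Proof.
rewrite /is_eigenprojection; have := mxrank_mxindex A.
move: (A ^+ mxindex A) => B rkB; pose C := B^T.
have rkC : \rank (C *m C) = \rank C by rewrite -trmx_mul !mxrank_tr.
have cap0 : (kermx C :&: C = 0)%MS.
  apply/eqP; rewrite capmxC -mxrank_eq0 -(eqn_add2l (\rank (C *m C))).
  by rewrite mxrank_mul_ker addn0 rkC.
have full : (1%:M <= kermx C + C)%MS.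
  rewrite sub1mx /row_full; apply/eqP.
  have := mxrank_sum_cap (kermx C) C.
  by rewrite cap0 mxrank0 addn0 mxrank_ker subnK ?rank_leq_row.
pose W := proj_mx (kermx C) C.
have WC : W *m C = 0.
  by apply/sub_kermxP; rewrite -[W]mul1mx proj_mx_sub.
have CW : C *m W = 0 by rewrite proj_mx_0.
have kW (u : 'rV_n) : u *m C = 0 -> u *m W = u.
  by move=> /sub_kermxP uC; rewrite proj_mx_id.
have WW : W *m W = W by rewrite proj_mx_id // -[W]mul1mx proj_mx_sub.
have rW (u : 'rV_n) : (u - u *m W <= C)%MS.
  by rewrite proj_mx_compl_sub // (submx_trans (submx1 _)).
exists W^T; split.
- by rewrite -trmx_mul WW.
- apply/seteqP; split=> [x [y _ <-]|x Bx] /=.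
    by rewrite /mxnull /= mulmxA -[B]trmxK -trmx_mul -/C WC trmx0 mul0mx.
  exists x => //; apply: trmx_inj; rewrite trmx_mul trmxK kW //.
  by rewrite -trmx_mul Bx trmx0.
- apply/seteqP; split=> [x Wx|x [y _ <-]] /=.
    have := rW x^T; have -> : x^T *m W = 0 by rewrite -[W]trmxK -trmx_mul Wx trmx0.
    rewrite subr0 => /submxP[D xE]; exists D^T => //.
    by apply: trmx_inj; rewrite trmx_mul trmxK xE.
  by rewrite /mxnull /= mulmxA -[B]trmxK -trmx_mul -/C CW trmx0 mul0mx.
Qed.

Lemma eigenprojection_unique (F : fieldType) (n : nat) (A Z1 Z2 : 'M[F]_n) :
  is_eigenprojection A Z1 -> is_eigenprojection A Z2 -> Z1 = Z2.
Proof.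
move=> [id1 r1 k1] [id2 r2 k2].
have mulI (M N : 'M[F]_n) : (forall x : 'cV_n, M *m x = N *m x) -> M = N.
  move=> MN; apply/matrixP => i j.
  have /matrixP/(_ i 0) : col j M = col j N by rewrite !colE MN.
  by rewrite !mxE.
apply: mulI => x.
have : mxrange Z2 (Z1 *m x) by rewrite r2 -r1; exists x.
case=> y _ Z2y.
have : mxnull Z2 (x - Z1 *m x).
  by rewrite k2 -k1 /mxnull /= mulmxBr mulmxA id1 subrr.
rewrite /mxnull /= mulmxBr => /subr0_eq ->.
by rewrite -Z2y mulmxA id2.
Qed.

(* Main.v *)
(* Both limits rest on one estimate for M = I + gamma (I - P), gamma >= 0:
   (1 + gamma) u = M u + gamma P u and the sup norm does not grow under P, so
   |u| <= |M u|. Thus M is invertible and its inverse is a contraction.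
   The iteration matrix Q and W = V M^-1 satisfy Q W = W Q = W, whence
   x^k - W x^0 = (1 - delta)^k (I - W) P^k x^0, which tends to 0.
   The estimate also gives N((I - P)^2) = N(I - P), so (I - P) J = 0 and
   I - J maps into the range of I - P. If x^0 - J x^0 = (I - P) y, then
   gamma (M^-1 x^0 - J x^0) = y - M^-1 y is bounded while gamma -> +oo. *)
Require Import Defs.
From HB Require Import structures.
From mathcomp Require Import all_boot all_order all_algebra.
From mathcomp Require Import all_classical all_reals all_analysis.
From mathcomp Require Import lra.

Set Implicit Arguments.
Unset Strict Implicit.
Unset Printing Implicit Defensive.

Import Order.TTheory GRing.Theory Num.Theory.
Import numFieldNormedType.Exports.

Local Open Scope classical_set_scope.
Local Open Scope ring_scope.

Lemma mx_norm_le (R : realType) (m p : nat) (A : 'M[R]_(m, p)) (c : R) :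
  0 <= c -> (forall i j, `|A i j| <= c) -> `|A| <= c.
Proof.
move=> c0 Ac; rewrite [leLHS]/Num.norm /= mx_normrE.
by apply/bigmax_leP; split=> // ij _; exact: Ac.
Qed.

Lemma norm_entry_le (R : realType) (m p : nat) (A : 'M[R]_(m, p)) i j :
  `|A i j| <= `|A|.
Proof.
rewrite [leRHS]/Num.norm /= mx_normrE; apply/bigmax_geP; right.
by exists (i, j).
Qed.

Lemma row_stochastic_norm_le (R : realType) (n p : nat) (P : 'M[R]_n)
    (u : 'M[R]_(n, p)) :
  row_stochastic P -> `|P *m u| <= `|u|.
Proof.
move=> [P0 P1]; apply: mx_norm_le => // i j; rewrite mxE.
apply: le_trans (ler_norm_sum _ _ _) _.
rewrite -[leRHS]mul1r -(P1 i) mulr_suml; apply: ler_sum => k _.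
by rewrite normrM ger0_norm // ler_wpM2l // norm_entry_le.
Qed.

Lemma row_stochastic_mul_const (R : realType) (n p : nat) (P : 'M[R]_n) (a : R) :
  row_stochastic P -> P *m (const_mx a : 'M[R]_(n, p)) = const_mx a.
Proof.
move=> [_ P1]; apply/matrixP => i j; rewrite !mxE.
by under eq_bigr do rewrite mxE; rewrite -mulr_suml P1 mul1r.
Qed.

Lemma row_stochastic_const_mul (R : realType) (n : nat) (v : 'cV[R]_n) :
  (forall i, 0 <= v i 0) -> \sum_i v i 0 = 1 ->
  row_stochastic ((const_mx 1 : 'cV[R]_n) *m v^T).
Proof.
move=> v0 v1; have E i j : (const_mx 1 *m v^T : 'M[R]_n) i j = v j 0.
  by rewrite mxE big_ord1 !mxE mul1r.
split=> [i j|i]; first by rewrite E.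
by under eq_bigr do rewrite E.
Qed.

Lemma norm_le_resolvent (R : realType) (n p : nat) (P : 'M[R]_n) (gamma : R)
    (u : 'M[R]_(n, p)) :
  row_stochastic P -> 0 <= gamma ->
  `|u| <= `|(1%:M + gamma *: (1%:M - P)) *m u|.
Proof.
move=> hP g0; set M := 1%:M + _.
have E : (1 + gamma) *: u = M *m u + gamma *: (P *m u).
  rewrite /M mulmxDl mul1mx -scalemxAl mulmxBl mul1mx scalerBr scalerDl scale1r.
  by rewrite -addrA subrK.
have : `|(1 + gamma) *: u| <= `|M *m u| + gamma * `|u|.
  rewrite E; apply: le_trans (ler_normD _ _) _; rewrite lerD2l normrZ ger0_norm //.
  by rewrite ler_wpM2l // row_stochastic_norm_le.
by rewrite normrZ ger0_norm ?addr_ge0 // mulrDl mul1r lerD2r.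
Qed.

Lemma resolvent_unitmx (R : realType) (n : nat) (P : 'M[R]_n) (gamma : R) :
  row_stochastic P -> 0 <= gamma -> 1%:M + gamma *: (1%:M - P) \in unitmx.
Proof.
move=> hP g0; set M := 1%:M + _.
rewrite -unitmx_tr -row_free_unit -kermx_eq0 -trmx_eq0 -normr_le0.
apply: le_trans (norm_le_resolvent _ hP g0) _; rewrite -/M.
have -> : M *m (kermx M^T)^T = (kermx M^T *m M^T)^T by rewrite [in RHS]trmx_mul trmxK.
by rewrite mulmx_ker trmx0 normr0.
Qed.

Lemma norm_invmx_resolvent_le (R : realType) (n p : nat) (P : 'M[R]_n)
    (gamma : R) (u : 'M[R]_(n, p)) :
  row_stochastic P -> 0 <= gamma ->
  `|invmx (1%:M + gamma *: (1%:M - P)) *m u| <= `|u|.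
Proof.
move=> hP g0; apply: le_trans (norm_le_resolvent _ hP g0) _.
by rewrite mulKVmx // resolvent_unitmx.
Qed.

Lemma laplacian_null_sq (R : realType) (n p : nat) (P : 'M[R]_n)
    (u : 'M[R]_(n, p)) :
  row_stochastic P ->
  (1%:M - P) *m ((1%:M - P) *m u) = 0 -> (1%:M - P) *m u = 0.
Proof.
move=> hP; set L := 1%:M - P; set w := L *m u => Lw.
have bound (g : R) : 0 <= g -> g * `|w| <= `|u| + `|u|.
  move=> g0; have := norm_le_resolvent (u - g *: w) hP g0.
  rewrite -/L mulmxDl mul1mx -scalemxAl mulmxBr -scalemxAr Lw scaler0 subr0 -/w.
  rewrite subrK => ule.
  have -> : g * `|w| = `|u - (u - g *: w)| by rewrite subKr normrZ ger0_norm.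
  by apply: le_trans (ler_normB _ _) _; rewrite lerD2l.
apply/eqP; rewrite -normr_eq0; apply/negP => /negP w0.
have g0 : 0 <= (`|u| + `|u| + 1) / `|w| by rewrite divr_ge0 // !addr_ge0.
by have := bound _ g0; rewrite divfK // leNgt ltrDl ltr01.
Qed.

Lemma laplacian_null_exp (R : realType) (n k : nat) (P : 'M[R]_n) (u : 'cV[R]_n) :
  row_stochastic P -> (1%:M - P) ^+ k *m u = 0 -> (1%:M - P) *m u = 0.
Proof.
move=> hP; elim: k u => [|k IHk] u; first by rewrite mul1mx => ->; rewrite mulmx0.
by rewrite exprSr -mulmxA => /IHk; exact: laplacian_null_sq.
Qed.

Lemma mxrange_expS (F : fieldType) (n k : nat) (A : 'M[F]_n) :
  \rank (A ^+ k.+1) = \rank (A ^+ k) ->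
  exists D : 'M[F]_n, A ^+ k = A ^+ k.+1 *m D.
Proof.
move=> rkE; have sub : ((A ^+ k.+1)^T <= (A ^+ k)^T)%MS.
  by rewrite exprSr trmx_mul submxMl.
have [_] := mxrank_leqif_sup sub; rewrite !mxrank_tr rkE eqxx => /esym /submxP[D E].
by exists D^T; apply: trmx_inj; rewrite trmx_mul trmxK.
Qed.

Lemma mxrank_exp_mxindexS (F : fieldType) (n : nat) (A : 'M[F]_n) :
  \rank (A ^+ (mxindex A).+1) = \rank (A ^+ mxindex A).
Proof. by rewrite /mxindex; case: ex_minnP => k /eqP. Qed.

Lemma laplacian_eigenprojection_null (R : realType) (n : nat) (P J : 'M[R]_n)
    (u : 'cV[R]_n) :
  row_stochastic P -> is_eigenprojection (1%:M - P) J ->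
  (1%:M - P) *m (J *m u) = 0.
Proof.
move=> hP [_ rJ _]; apply: laplacian_null_exp (mxindex (1%:M - P)) _ _ hP _.
have : mxrange J (J *m u) by exists u.
by rewrite rJ.
Qed.

Lemma eigenprojection_compl (F : fieldType) (n : nat) (A J : 'M[F]_n)
    (u : 'cV[F]_n) :
  is_eigenprojection A J -> exists y : 'cV[F]_n, u - J *m u = A *m y.
Proof.
move=> [JJ _ kJ]; have : mxnull J (u - J *m u).
  by rewrite /mxnull /= mulmxBr mulmxA JJ subrr.
rewrite kJ => -[y _ <-].
have [D ->] := mxrange_expS (mxrank_exp_mxindexS A).
by exists (A ^+ mxindex A *m D *m y); rewrite exprS !mulmxA.
Qed.

Lemma resolvent_eigenprojection (R : realType) (n : nat) (P J : 'M[R]_n)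
    (u : 'cV[R]_n) :
  row_stochastic P -> is_eigenprojection (1%:M - P) J ->
  exists2 C : R, 0 <= C & forall gamma : R, 0 <= gamma ->
    gamma * `|invmx (1%:M + gamma *: (1%:M - P)) *m u - J *m u| <= C.
Proof.
move=> hP hJ; have LJ := laplacian_eigenprojection_null u hP hJ.
have [y Ey] := eigenprojection_compl u hJ.
exists (`|y| + `|y|); first exact: addr_ge0.
move=> g g0; have N_le := norm_invmx_resolvent_le y hP g0.
have Mu := resolvent_unitmx hP g0.
move: LJ Ey N_le Mu; set L := 1%:M - P => LJ Ey.
set M := 1%:M + g *: L => N_le Mu.
have NJ : invmx M *m (J *m u) = J *m u.
  rewrite -[in LHS](_ : M *m (J *m u) = J *m u) ?mulKmx //.
  by rewrite mulmxDl mul1mx -scalemxAl LJ scaler0 addr0.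
have E : g *: (invmx M *m u - J *m u) = y - invmx M *m y.
  rewrite -{1}NJ -mulmxBr Ey scalemxAr.
  have -> : g *: (L *m y) = M *m y - y.
    by rewrite [M *m y]mulmxDl mul1mx -scalemxAl addrC addKr.
  by rewrite mulmxBr mulKmx.
rewrite -[g in g * _]ger0_norm // -normrZ E.
by apply: le_trans (ler_normB _ _) _; rewrite lerD2l.
Qed.

Lemma teleportation_dist_le (R : realType) (n : nat) (P V : 'M[R]_n)
    (delta : R) (x : nat -> 'cV[R]_n) :
  row_stochastic P -> row_stochastic V -> P *m V = V -> V *m V = V ->
  0 < delta <= 1 ->
  (forall k, x k.+1 = ((1 - delta) *: P + delta *: V) *m x k) ->
  forall k,
    `|x k - V *m invmx (1%:M + (delta^-1 - 1) *: (1%:M - P)) *m x 0%N|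
      <= (1 - delta) ^+ k * (`|x 0%N| + `|x 0%N|).
Proof.
move=> hP hV PV VV /andP[d0 d1] xS.
have g0 : 0 <= delta^-1 - 1 by rewrite subr_ge0 invr_ge1 ?unitfE ?gt_eqF.
have Mu := resolvent_unitmx hP g0.
have N_le (u : 'cV[R]_n) := norm_invmx_resolvent_le u hP g0.
have dM : delta *: (1%:M + (delta^-1 - 1) *: (1%:M - P)) =
    1%:M - (1 - delta) *: P.
  rewrite scalerDr scalerA mulrBr mulfV ?gt_eqF // mulr1 scalerBr addrA -scalerDl.
  by rewrite [delta + _]addrC subrK scale1r.
have MV : (1%:M + (delta^-1 - 1) *: (1%:M - P)) *m V = V.
  by rewrite mulmxDl mul1mx -scalemxAl mulmxBl mul1mx PV subrr scaler0 addr0.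
move: Mu N_le dM MV; set M := 1%:M + _ => Mu N_le dM MV.
pose W := V *m invmx M; rewrite -/W.
pose Q := (1 - delta) *: P + delta *: V.
have NV : invmx M *m V = V by rewrite -{1}MV mulKmx.
have WV : W *m V = V by rewrite -mulmxA NV.
have QW : Q *m W = W.
  by rewrite mulmxA mulmxDl -!scalemxAl PV VV -scalerDl subrK scale1r.
have WQ : W *m Q = W.
  rewrite mulmxDr -!scalemxAr WV.
  have -> : delta *: V = W *m (delta *: M) by rewrite -scalemxAr mulmxKV.
  by rewrite dM mulmxBr mulmx1 -scalemxAr addrC subrK.
have W_le (u : 'cV[R]_n) : `|W *m u| <= `|u|.
  by rewrite -mulmxA; apply: le_trans (row_stochastic_norm_le _ hV) (N_le u).
suff xE k : exists2 u : 'cV[R]_n, `|u| <= `|x 0%N| &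
    x k - W *m x 0%N = (1 - delta) ^+ k *: (u - W *m u).
  move=> k; have [u ule ->] := xE k.
  rewrite normrZ ger0_norm ?exprn_ge0 ?subr_ge0 // ler_wpM2l ?exprn_ge0 ?subr_ge0 //.
  by apply: le_trans (ler_normB _ _) (lerD ule (le_trans (W_le u) ule)).
elim: k => [|k [u ule IHk]]; first by exists (x 0%N); rewrite ?expr0 ?scale1r.
exists (P *m u); first exact: le_trans (row_stochastic_norm_le _ hP) ule.
have -> : x k.+1 - W *m x 0%N = Q *m (x k - W *m x 0%N).
  by rewrite xS -/Q mulmxBr (mulmxA Q W) QW.
rewrite IHk -scalemxAr exprSr -scalerA; congr (_ *: _).
have -> : Q *m (u - W *m u) = (1%:M - W) *m (Q *m u).
  by rewrite mulmxBr mulmxBl mul1mx (mulmxA Q W) (mulmxA W Q) QW WQ.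
rewrite [Q *m u]mulmxDl -!scalemxAl mulmxDr -!scalemxAr [(1%:M - W) *m (V *m u)]mulmxA.
by rewrite [(1%:M - W) *m V]mulmxBl mul1mx WV subrr mul0mx scaler0 addr0 mulmxBl mul1mx.
Qed.

Theorem theorem5 (R : realType) (n : nat) (P J : 'M[R]_n) (v x0 : 'cV[R]_n)
    (x : R -> nat -> 'cV[R]_n)
    (hP : row_stochastic P)
    (hPreg : ~ regular P)
    (hJ : is_eigenprojection (1%:M - P) J)
    (hv0 : forall i, 0 <= v i 0)
    (hv1 : \sum_i v i 0 = 1)
    (hx0 : forall delta : R, 0 < delta <= 1 -> x delta 0%N = x0)
    (hxS : forall delta : R, 0 < delta <= 1 -> forall k : nat,
       x delta k.+1 =
         ((1 - delta) *: P + delta *: ((const_mx 1 : 'cV[R]_n) *m v^T))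
           *m x delta k) :
  [/\ (forall delta : R, 0 < delta <= 1 ->
         let gamma := delta^-1 - 1 in
         (1%:M + gamma *: (1%:M - P) \in unitmx) /\
         (x delta k @[k --> \oo] -->
            (const_mx 1 : 'cV[R]_n) *m v^T
              *m invmx (1%:M + gamma *: (1%:M - P)) *m x0)),
      (lim (x delta k @[k --> \oo]) @[delta --> 0^'+] -->
         (const_mx 1 : 'cV[R]_n) *m v^T *m J *m x0)
    & (v = n%:R^-1 *: const_mx 1 ->
         let E : 'M[R]_n :=
           n%:R^-1 *: ((const_mx 1 : 'cV[R]_n) *m (const_mx 1 : 'cV[R]_n)^T) in
         (lim (x delta k @[k --> \oo]) @[delta --> 0^'+] --> E *m J *m x0) /\
         E *m J *m x0 =
           (n%:R^-1 * \sum_j (\sum_i J i j) * x0 j 0) *: (const_mx 1 : 'cV[R]_n))].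
Proof.
set V := const_mx 1 *m v^T.
have hV : row_stochastic V by exact: row_stochastic_const_mul.
have PV : P *m V = V by rewrite mulmxA row_stochastic_mul_const.
have VV : V *m V = V by rewrite [LHS]mulmxA row_stochastic_mul_const.
have gamma_ge0 (delta : R) : 0 < delta <= 1 -> 0 <= delta^-1 - 1.
  by move=> /andP[d0 d1]; rewrite subr_ge0 invr_ge1 ?unitfE ?gt_eqF.
have cvg_x (delta : R) : 0 < delta <= 1 -> x delta k @[k --> \oo] -->
    V *m invmx (1%:M + (delta^-1 - 1) *: (1%:M - P)) *m x0.
  move=> hd; apply/subr_cvg0; apply: norm_cvg0.
  have dist_le := teleportation_dist_le hP hV PV VV hd (hxS delta hd).
  rewrite hx0 // in dist_le; case/andP: hd => d0 d1.
  apply: (@squeeze_cvgr _ _ _ _ (fun=> 0)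
    (fun k => (1 - delta) ^+ k * (`|x0| + `|x0|))).
  - by near=> k; rewrite normr_ge0 dist_le.
  - exact: cvg_cst.
  - rewrite -[X in _ --> X](mul0r (`|x0| + `|x0|)).
    apply: cvgMl; apply: cvg_expr.
    by rewrite ger0_norm ?subr_ge0 // ltrBlDr ltrDl.
have cvg_lim_x : lim (x delta k @[k --> \oo]) @[delta --> 0^'+] --> V *m J *m x0.
  have [C C0 HC] := resolvent_eigenprojection x0 hP hJ.
  apply/cvgrPdist_le => e e0; near=> delta.
  have d0 : 0 < delta by near: delta; exact: nbhs_right_gt.
  have dlt : delta < 2^-1 by near: delta; apply: nbhs_right_lt.
  have dle : delta <= e / (2 * (C + 1)).
    by near: delta; apply: nbhs_right_le; rewrite divr_gt0 ?mulr_gt0 ?ltr_wpDl.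
  have hd : 0 < delta <= 1 by rewrite d0 /=; lra.
  rewrite (cvg_lim _ (cvg_x delta hd)); last exact: norm_hausdorff.
  rewrite distrC -(mulmxA V J) -(mulmxA V (invmx _)) -mulmxBr.
  apply: le_trans (row_stochastic_norm_le _ hV) _.
  have := HC _ (gamma_ge0 _ hd); set r := `|_ - _| => gr.
  have r0 : 0 <= r by exact: normr_ge0.
  have {}gr : (1 - delta) * r <= delta * C.
    have -> : (1 - delta) * r = delta * ((delta^-1 - 1) * r).
      by rewrite mulrA mulrBr mulfV ?gt_eqF // mulr1.
    by rewrite ler_wpM2l // ltW.
  rewrite ler_pdivlMr ?mulr_gt0 ?ltr_wpDl // in dle.
  nra.
split=> //.
- by move=> delta hd gamma; split; [apply: resolvent_unitmx => //; exact: gamma_ge0|exact: cvg_x].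
- move=> vE E; have VE : V = E.
    by rewrite /V vE linearZ /= -scalemxAr.
  split; first by rewrite -VE.
  apply/matrixP => i j; rewrite ord1 /E !mxE mulr1 mulr_sumr; apply: eq_bigr => k _.
  rewrite mxE mulrA mulr_sumr; congr (_ * _); apply: eq_bigr => l _.
  by rewrite !mxE big_ord1 !mxE !mulr1.
Unshelve. all: by end_near.
Qed.
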